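(* Let $U\to V\to W$ be an exact sequence of moderate persistence modules over a field $\mathbb{K}$. Then for every $\delta>0$, $$\mathcal{N}_{2\delta}(V)\le\mathcal{N}_\delta(U)+\mathcal{N}_\delta(W).$$
   Context: A persistence module $(V,\pi)$ over a field $\mathbb{K}$ consists of $\mathbb{K}$-vector spaces $V_t$, $t\in\mathbb{R}$, and linear maps $\pi_{s,t}:V_s\to V_t$ for $s\le t$ with $\pi_{t,t}=\mathrm{id}$ and $\pi_{s,t}\circ\pi_{r,s}=\pi_{r,t}$ for $r\le s\le t$. A morphism is a family of linear maps $V_t\to W_t$ commuting with the structure maps; kernels, images and exactness are defined pointwise in $t$. $V$ is $q$-tame if $\pi_{s,t}$ has finite rank for all $s<t$; it is upper semi-continuous if the canonical map $V_t\to\lim_{s>t}V_s$ (inverse limit) is an isomorphism for all $t$. For an interval $I\subset\mathbb{R}$, $\mathbb{K}_I$ is the persistence module equal to $\mathbb{K}$ at $t\in I$ and $0$ otherwise, with identity structure maps between parameters in $I$. The barcode $\mathcal{B}(V)$ is the multiset of intervals (bars) $I$ in the interval decomposition of $V$ (direct product decomposition $V\cong\prod_{I\in\mathcal{B}(V)}\mathbb{K}_I$ for the upper semi-continuous $q$-tame modules considered here), and $\mathcal{N}_\delta(V)$ is the number of bars of length $>\delta$ in $\mathcal{B}(V)$, counted with multiplicity and including infinite bars. A persistence module $V$ is called moderate if it is $q$-tame, upper semi-continuous, has no intervals of the form $(-\infty,c)$ in its direct product decomposition, and $\mathcal{N}_\delta(V)$ is finite for all $\delta>0$. *)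

(* Defs.v *)
From HB Require Import structures.
From mathcomp Require Import all_boot all_order all_algebra.
From mathcomp Require Import boolp classical_sets functions cardinality.
From mathcomp Require Import set_interval reals ereal real_interval.
From mathcomp Require Import counting_measure.

Set Implicit Arguments.
Unset Strict Implicit.
Unset Printing Implicit Defensive.
Import Order.TTheory GRing.Theory Num.Theory.
Local Open Scope classical_set_scope.
Local Open Scope ring_scope.

Record pmodule (R : realType) (K : fieldType) := PModule {
  pm_space :> R -> lmodType K;
  pm_map : forall s t : R, s <= t -> {linear pm_space s -> pm_space t};
  pm_map_id : forall (t : R) (tt : t <= t) (v : pm_space t),
    pm_map tt v = v;
  pm_map_comp : forall (r s t : R) (rs : r <= s) (st : s <= t) (rt : r <= t)
    (v : pm_space r), pm_map st (pm_map rs v) = pm_map rt v }.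

Record pmorphism (R : realType) (K : fieldType) (V W : pmodule R K) :=
  PMorphism {
    pmor :> forall t : R, {linear V t -> W t};
    pmor_natural : forall (s t : R) (st : s <= t) (v : V s),
      pmor t (pm_map V st v) = pm_map W st (pmor s v) }.

(* The pointwise inverse of a pointwise bijective morphism is automatically a
   morphism. *)
Definition pisomorphic (R : realType) (K : fieldType) (V W : pmodule R K) :=
  exists f : pmorphism V W, forall t : R, bijective (f t).

Definition pexact (R : realType) (K : fieldType) (U V W : pmodule R K)
    (f : pmorphism U V) (g : pmorphism V W) :=
  forall t : R, range (f t) = [set v : V t | g t v = 0].

Definition finite_rank (K : fieldType) (E F : lmodType K)
    (f : {linear E -> F}) :=
  exists (n : nat) (e : 'I_n -> E), forall x : E, exists c : 'I_n -> K,
    f x = \sum_(i < n) c i *: f (e i).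

Definition qtame (R : realType) (K : fieldType) (V : pmodule R K) :=
  forall (s t : R) (st : s < t), finite_rank (pm_map V (ltW st)).

(* Elements of the inverse limit of the V s over s > t. *)
Definition compatible (R : realType) (K : fieldType) (V : pmodule R K) (t : R)
    (x : forall s : R, t < s -> V s) :=
  forall (s s' : R) (ts : t < s) (ts' : t < s') (ss' : s <= s'),
    pm_map V ss' (x s ts) = x s' ts'.

(* The canonical map from V t to the inverse limit is linear, so it is an
   isomorphism as soon as it is bijective. *)
Definition upper_semicontinuous (R : realType) (K : fieldType)
    (V : pmodule R K) :=
  forall (t : R) (x : forall s : R, t < s -> V s), compatible x ->
    exists! v : V t, forall (s : R) (ts : t < s),
      pm_map V (ltW ts) v = x s ts.

Section IntervalModule.
Variables (R : realType) (K : fieldType) (I : interval R).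

(* The boolean [t \in I] is read as a dimension: K^1 inside I, K^0 outside. *)
Definition itv_space (t : R) : lmodType K := 'rV[K]_(t \in I).

(* [pid_mx 1] is the identity if s and t are in I, and has an empty row or
   column set otherwise. *)
Definition itv_map (s t : R) (st : s <= t) :
  {linear itv_space s -> itv_space t} := mulmxr (pid_mx 1).

Lemma itv_map_id (t : R) (tt : t <= t) (v : itv_space t) : itv_map tt v = v.
Proof.
suff pid1 (b : bool) : pid_mx 1 = 1%:M :> 'M[K]_b.
  by change (v *m pid_mx 1 = v); rewrite pid1 mulmx1.
by case: b; [exact: pid_mx_1 | rewrite !thinmx0].
Qed.

Lemma itv_map_comp (r s t : R) (rs : r <= s) (st : s <= t) (rt : r <= t)
  (v : itv_space r) : itv_map st (itv_map rs v) = itv_map rt v.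
Proof.
have conv : r \in I -> t \in I -> s \in I.
  case: I => a b; rewrite !itv_boundlr => /andP[Ir _] /andP[_ tI].
  apply/andP; split; first by apply: le_trans Ir _; rewrite bnd_simp.
  by apply: le_trans tI; rewrite bnd_simp.
suff pidM (a b c : bool) : (a -> c -> b) ->
    (pid_mx 1 : 'M[K]_(a, b)) *m (pid_mx 1 : 'M[K]_(b, c)) = pid_mx 1.
  change (v *m (pid_mx 1 : 'M_(r \in I, s \in I))
            *m (pid_mx 1 : 'M_(s \in I, t \in I)) = v *m pid_mx 1).
  by rewrite -mulmxA pidM.
case: a; last by move=> _; rewrite [LHS]flatmx0 [RHS]flatmx0.
case: c; last by move=> _; rewrite [LHS]thinmx0 [RHS]thinmx0.
by case: b => [_|/(_ isT isT)//]; rewrite !pid_mx_1 mulmx1.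
Qed.

Definition interval_module : pmodule R K := PModule itv_map_id itv_map_comp.

End IntervalModule.
Arguments interval_module {R} K I.

Definition lmod_prod (K : fieldType) (J : Type) (E : J -> lmodType K) :=
  forall j, E j.

Section LmodProd.
Variables (K : fieldType) (J : Type) (E : J -> lmodType K).
Implicit Types (x y z : lmod_prod E) (a b : K).

HB.instance Definition _ := gen_eqMixin (lmod_prod E).
HB.instance Definition _ := gen_choiceMixin (lmod_prod E).

Let zero : lmod_prod E := fun=> 0.
Let opp x : lmod_prod E := fun j => - x j.
Let add x y : lmod_prod E := fun j => x j + y j.
Let scale a x : lmod_prod E := fun j => a *: x j.

Let addA : associative add.
Proof. by move=> x y z; apply: functional_extensionality_dep => j; exact: addrA. Qed.
Let addC : commutative add.
Proof. by move=> x y; apply: functional_extensionality_dep => j; exact: addrC. Qed.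
Let add0 : left_id zero add.
Proof. by move=> x; apply: functional_extensionality_dep => j; exact: add0r. Qed.
Let addN : left_inverse zero opp add.
Proof. by move=> x; apply: functional_extensionality_dep => j; exact: addNr. Qed.

HB.instance Definition _ :=
  GRing.isZmodule.Build (lmod_prod E) addA addC add0 addN.

Let scaleA a b x : scale a (scale b x) = scale (a * b) x.
Proof. by apply: functional_extensionality_dep => j; exact: scalerA. Qed.
Let scale1 : left_id 1 scale.
Proof. by move=> x; apply: functional_extensionality_dep => j; exact: scale1r. Qed.
Let scaleDr : right_distributive scale +%R.
Proof. by move=> a x y; apply: functional_extensionality_dep => j; exact: scalerDr. Qed.
Let scaleDl x : {morph scale^~ x : a b / a + b}.
Proof. by move=> a b; apply: functional_extensionality_dep => j; exact: scalerDl. Qed.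

HB.instance Definition _ := GRing.Zmodule_isLmodule.Build K (lmod_prod E)
  scaleA scale1 scaleDr scaleDl.

End LmodProd.

Section ProductModule.
Variables (R : realType) (K : fieldType) (J : Type) (M : J -> pmodule R K).

Definition prod_space (t : R) : lmodType K := lmod_prod (fun j => M j t).

Definition prod_fun (s t : R) (st : s <= t) (x : prod_space s) :
  prod_space t := fun j => pm_map (M j) st (x j).

Lemma prod_fun_linear (s t : R) (st : s <= t) : linear (prod_fun st).
Proof. by move=> a x y; apply: functional_extensionality_dep => j; exact: linearP. Qed.

HB.instance Definition _ (s t : R) (st : s <= t) :=
  GRing.isLinear.Build K (prod_space s) (prod_space t) *:%R (prod_fun st)
    (prod_fun_linear st).

Definition prod_map (s t : R) (st : s <= t) :
  {linear prod_space s -> prod_space t} := prod_fun st.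

Lemma prod_map_id (t : R) (tt : t <= t) (x : prod_space t) :
  prod_map tt x = x.
Proof. by apply: functional_extensionality_dep => j; exact: pm_map_id. Qed.

Lemma prod_map_comp (r s t : R) (rs : r <= s) (st : s <= t) (rt : r <= t)
  (x : prod_space r) : prod_map st (prod_map rs x) = prod_map rt x.
Proof. by apply: functional_extensionality_dep => j; exact: pm_map_comp. Qed.

Definition prod_module : pmodule R K := PModule prod_map_id prod_map_comp.

End ProductModule.

(* A multiset of intervals, as an indexed family. *)
Record barcode (R : realType) := Barcode {
  bar_index : choiceType;
  bar :> bar_index -> interval R }.

Definition is_barcode (R : realType) (K : fieldType) (V : pmodule R K)
    (B : barcode R) :=
  (forall j : bar_index B, neitv (B j)) /\
  pisomorphic V (prod_module (fun j : bar_index B => interval_module K (B j))).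

(* Meaningful for nonempty intervals; +oo if an endpoint is infinite. *)
Definition itv_length (R : realType) (I : interval R) : \bar R :=
  ((I.2 : \bar R) - (I.1 : \bar R))%E.

(* The value is +oo if there are infinitely many bars of length > d. *)
Definition nbars (R : realType) (d : R) (B : barcode R) : \bar R :=
  counting [set j : bar_index B | (d%:E < itv_length (B j))%E].

(* All barcodes of a q-tame upper semi-continuous V agree up to reindexing
   (count ranks of structure maps), so it does not matter which one is used.
   A bar equal to the whole line is allowed. *)
Definition moderate (R : realType) (K : fieldType) (V : pmodule R K) :=
  [/\ qtame V, upper_semicontinuous V &
      exists B : barcode R, [/\ is_barcode V B,
        forall (j : bar_index B) (c : R), B j <> `]-oo, c[ &
        forall d : R, 0 < d -> (nbars d B < +oo)%E]].

(* Main.v *)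
Require Import Defs.
From HB Require Import structures.
From mathcomp Require Import all_boot all_order all_algebra.
From mathcomp Require Import finmap.
From mathcomp Require Import boolp classical_sets reals ereal.
From mathcomp Require Import functions cardinality counting_measure.
From mathcomp Require Import lra.

(** A bar of [V] of length more than [2 * d] contains times [s < r < t] with
gaps [r - s] and [t - r] both larger than [d].  Take [n] such bars, sorted by
their middle time [r], and let [e i], in degree [s i], generate the [i]-th one.
The proof is a rank count carried out twice, once in [W] between the times
[s] and [r] and once in [U] between the times [r] and [t].

In any module with a barcode, an element that has survived for longer than [d]
has zero coordinate on every bar of length at most [d].  So after a delay [d]
the only coordinates left are those on the long bars; if there are [p] of them,
then among any sequence of elements [w 0, w 1, ...], born at arbitrary times,
all but [p] become linear combinations of their predecessors as soon as
everybody is older than [d] ([eventual_dependence]).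

Applied to [g (e i)] in [W], this says that for all but [N_d(W)] indices [l]
some combination [y l = e l - (earlier e i)] is killed by [g] at time [r l].
By exactness [y l = f (u l)] with [u l] in [U] at time [r l].  Applied to the
[u l], it says that if more than [N_d(U)] of these existed, one of them would
be, at time [t l], a combination of earlier ones.  The image of that relation
under [f] is impossible: the [l]-th bar of [V] is still alive at time [t l],
where [y l] has coordinate 1 on it, whereas the earlier [y i] involve only
earlier bars and have coordinate 0 ([long_bars_le]).

In both counts the dependence is on earlier elements in the same order, so each
[y l] keeps [e l] as its leading term; hence every index is used up by one of
the two counts, and they add up to at least [n]. *)

Import Order.TTheory GRing.Theory Num.Theory.
Local Open Scope ring_scope.

Set Implicit Arguments.
Unset Strict Implicit.
Unset Printing Implicit Defensive.

(** * Counting new directions in a sequence of vectors *)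

Section Fresh.
Variables (K : fieldType) (E : vectType K).

Definition fresh (v : nat -> E) (i : nat) : bool :=
  v i \notin (\sum_(j < i) <[v j]>)%VS.

(** Each fresh vector raises the dimension of the span of the initial
segment by one. *)
Lemma sum_fresh_le (v : nat -> E) (n : nat) :
  (\sum_(i < n) fresh v i <= dim E)%N.
Proof.
suff: (\sum_(i < n) fresh v i <= \dim (\sum_(j < n) <[v j]>))%N.
  by move/leq_trans; apply; rewrite -[leqRHS]dimvf dimvS ?subvf.
elim: n => [|n IHn]; first by rewrite big_ord0.
rewrite !big_ord_recr /=; set X := (\sum_(_ < n) _)%VS in IHn *.
rewrite /fresh -/X; case: (boolP (v n \in X)) => vX.
  by rewrite addn0 (leq_trans IHn)// dimvS// addvSl.
rewrite addn1 (leq_ltn_trans IHn)// ltn_neqAle dimvS ?addvSl// andbT.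
have /dimv_leqif_sup [_ ->] := addvSl X <[v n]>%VS.
by rewrite subv_add subvv /= -memvE.
Qed.

Lemma not_freshP (v : nat -> E) (l : nat) :
  ~~ fresh v l -> exists c : 'I_l -> K, v l = \sum_(i < l) c i *: v i.
Proof.
rewrite negbK => /memv_sumP[u uv vE].
have /choice [c cE] (i : 'I_l) : exists k, u i = k *: v i.
  exact/vlineP/uv.
by exists c; rewrite vE; apply: eq_bigr.
Qed.

End Fresh.

(** * Structure maps at arbitrary pairs of times *)

Section Shift.
Variables (R : realType) (K : fieldType).
Implicit Types (V W : pmodule R K).

(** The structure maps, extended by zero to [t < s], so that sums of elements
born at different times can be written without carrying order proofs. *)
Definition shift V (s t : R) : {linear V s -> V t} :=
  match @idP (s <= t) with
  | ReflectT st => pm_map V st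
  | ReflectF _ => (\0 : {linear V s -> V t})
  end.

Lemma shiftE V (s t : R) (st : s <= t) (v : V s) :
  shift V s t v = pm_map V st v.
Proof.
rewrite /shift; case: {-}_ / idP => [st'|//].
by rewrite (bool_irrelevance st' st).
Qed.

Lemma shift_comp V (s r t : R) (v : V s) : s <= r -> r <= t ->
  shift V r t (shift V s r v) = shift V s t v.
Proof.
move=> sr rt; rewrite (shiftE sr) (shiftE rt) (shiftE (le_trans sr rt)).
exact: pm_map_comp.
Qed.

Lemma pmor_shift V W (f : pmorphism V W) (s t : R) (v : V s) :
  f t (shift V s t v) = shift W s t (f s v).
Proof.
rewrite /shift; case: {-}_ / idP => [st|_]; last exact: linear0.
exact: pmor_natural.
Qed.

End Shift.

(** * Scalar coordinates along a barcode *)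

Section Coordinates.
Variables (R : realType) (K : fieldType).

(** The space of an interval module is ['rV_1] or ['rV_0]; summing the entries
reads off the scalar in the first case and gives zero in the second, with no
case distinction in the type. *)
Definition row_sum (b : bool) (x : 'rV[K]_b) : K := \sum_k x 0 k.

Lemma row_sum_pid (a b : bool) (x : 'rV[K]_a) :
  row_sum (x *m (pid_mx 1 : 'M_(a, b))) = if b then row_sum x else 0.
Proof.
case: b; last by rewrite /row_sum big_ord0.
by case: a x => x; [rewrite pid_mx_1 mulmx1 | rewrite [x]thinmx0 mul0mx
  /row_sum big_ord0 big_ord_recl big_ord0 mxE addr0].
Qed.

Lemma row_sum_out (b : bool) (x : 'rV[K]_b) : ~~ b -> row_sum x = 0.
Proof. by case: b x => // x _; rewrite /row_sum big_ord0. Qed.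

Lemma row_sum_eq0 (b : bool) (x : 'rV[K]_b) : row_sum x = 0 -> x = 0.
Proof.
case: b x => x; last by rewrite [x]thinmx0.
rewrite /row_sum big_ord_recl big_ord0 addr0 => x0.
by apply/rowP => k; rewrite ord1 x0 mxE.
Qed.

Lemma row_sum_const (b : bool) (c : K) :
  b -> row_sum (const_mx c : 'rV[K]_b) = c.
Proof. by case: b => // _; rewrite /row_sum big_ord_recl big_ord0 mxE addr0. Qed.

(** All that is used of an interval decomposition: coordinates that are
preserved by the structure maps as long as the target time lies in the bar (if
the source time precedes the bar, both coordinates are zero), that detect
zero, and that admit dual vectors. *)
Lemma coordinates (M : pmodule R K) (B : barcode R) : is_barcode M B ->
  exists x : forall t : R, bar_index B -> {scalar M t},
  [/\ forall s t j v, s <= t ->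
        x t j (shift M s t v) = if t \in B j then x s j v else 0,
      forall s j v, s \notin B j -> x s j v = 0,
      forall t v, (forall j, x t j v = 0) -> v = 0 &
      forall s j, s \in B j -> exists v, forall i, x s i v = (i == j)%:R].
Proof.
move=> [_ [f fbij]].
pose x t j (v : M t) : K := row_sum (f t v j).
have xlin t j : scalar (x t j).
  move=> a u v; rewrite /x linearP /row_sum mulr_sumr -big_split /=.
  by apply: eq_bigr => k _; rewrite !mxE.
pose X t j : {scalar M t} :=
  HB.pack (x t j) (GRing.isLinear.Build _ _ _ _ (x t j) (xlin t j)).
exists X; split => /=.
- move=> s t j v st; rewrite /x (shiftE st) pmor_natural.
  exact: row_sum_pid.
- by move=> s j v; exact: row_sum_out.
- move=> t v v0; apply: (bij_inj (fbij t)); rewrite linear0.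
  by apply: functional_extensionality_dep => j; exact/row_sum_eq0/v0.
- move=> s j sB; have [h hK fK] := fbij s.
  exists (h (fun i => const_mx (i == j)%:R)) => i; rewrite /x fK.
  have [->|ij] := eqVneq i j; first exact: row_sum_const.
  by rewrite /row_sum big1// => k _; rewrite mxE.
Qed.

End Coordinates.

(** * Lengths of intervals *)

Lemma itv_length_gt (R : realType) (I : interval R) (d s t : R) :
  s \in I -> t \in I -> s + d < t -> (d%:E < itv_length I)%E.
Proof.
rewrite /itv_length !inE; case: I => -[a x|[]] [b y|[]] //= /andP[sl su] /andP[tl tu] st;
  rewrite ?ltry//.
rewrite lte_fin.
have xs : x <= s by move: sl; case: (a); rewrite bnd_simp // => /ltW.
have ty : t <= y by move: tu; case: (b); rewrite bnd_simp // => /ltW.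
lra.
Qed.

Lemma itv_length_points (R : realType) (I : interval R) (d : R) : 0 < d ->
  ((2 * d)%:E < itv_length I)%E ->
  exists p : R * R * R, [/\ p.1.1 \in I, p.2 \in I, p.1.1 + d < p.1.2 & p.1.2 + d < p.2].
Proof.
move=> d0; case: I => [[a x|[]] [b y|[]]] //; rewrite /itv_length /=.
- rewrite lte_fin => xy.
  (* Each half of the bar is longer than [d] by [(y - x - 2 * d) / 2]; [e] only
     has to be smaller than that. *)
  pose e := (y - x - 2 * d) / 4.
  exists (x + e, (x + y) / 2, y - e) => /=.
  by rewrite !itv_boundlr /e; split; case: (a); case: (b); rewrite ?bnd_simp /=; lra.
- move=> _; exists (x + 1, x + 1 + 2 * d, x + 1 + 4 * d) => /=.
  by rewrite !itv_boundlr; split; case: (a); rewrite ?bnd_simp /=; lra.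
- move=> _; exists (y - 1 - 4 * d, y - 1 - 2 * d, y - 1) => /=.
  by rewrite !itv_boundlr; split; case: (b); rewrite ?bnd_simp /=; lra.
- by move=> _; exists (0, 2 * d, 4 * d) => /=; split => //; lra.
Qed.

(** * Eventual linear dependence *)

(** An element in a bar of length at most [d] dies within time [d], so the
coordinates on the bars listed in [L] decide all relations between elements
older than [d].  Such a coordinate does not change between birth and time [t]
unless the bar has ended, when it vanishes; hence the coordinate vectors may be
read off at birth, whatever the birth times, and the fresh ones among them are
at most [size L] in number. *)
Lemma eventual_dependence (R : realType) (K : fieldType) (M : pmodule R K)
    (B : barcode R) (d : R) (L : seq (bar_index B)) (s : nat -> R)
    (w : forall i, M (s i)) :
  is_barcode M B -> 0 < d ->
  (forall j, (d%:E < itv_length (B j))%E -> j \in L) ->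
  exists fr : nat -> bool,
    (forall n, (\sum_(i < n) fr i <= size L)%N) /\
    forall l, ~~ fr l -> exists c : 'I_l -> K, forall t,
      (forall i, (i <= l)%N -> s i + d < t) ->
      shift M (s l) t (w l) = \sum_(i < l) c i *: shift M (s i) t (w i).
Proof.
move=> /coordinates [x [xshift x0 xinj _]] d0 hL.
pose v i : 'rV[K]_(size L) := \row_k x (s i) (tnth (in_tuple L) k) (w i).
exists (fresh v); split => [n|l /not_freshP[c vE]].
  by apply: leq_trans (sum_fresh_le v n) _; rewrite dim_matrix mul1r.
exists c => t st; have sle i : (i <= l)%N -> s i <= t.
  by move=> /st; lra.
apply/eqP; rewrite -subr_eq0; apply/eqP/xinj => j.
rewrite linearB linear_sum /= xshift ?sle//.
have -> : \sum_(i < l) x t j (c i *: shift M (s i) t (w i)) =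
    \sum_(i < l) (if t \in B j then c i * x (s i) j (w i) else 0).
  apply: eq_bigr => i _; rewrite linearZ /= xshift ?sle ?(ltnW (ltn_ord i))//.
  by case: ifP; rewrite ?mulr0.
case: ifPn => tB; last by rewrite big1 ?subrr.
have [jL|jL] := boolP (j \in L); last first.
  have xj0 i : (i <= l)%N -> x (s i) j (w i) = 0.
    move=> il; apply: x0; apply: contra jL => sB.
    exact/hL/(itv_length_gt sB tB)/st.
  rewrite xj0// big1 ?subrr// => i _.
  by rewrite xj0 ?mulr0// ltnW.
have [k jE] : exists k, j = tnth (in_tuple L) k by apply/tnthP.
move/rowP: vE => /(_ k); rewrite mxE -jE => ->.
rewrite summxE; apply/eqP; rewrite subr_eq0; apply/eqP/eq_bigr => i _.
by rewrite !mxE -jE.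
Qed.

(** * The two rank counts *)

(** The middle times [r] have to be sorted: at time [r l] every
earlier [e i] is then older than [d], and likewise every earlier [u i] at
time [t l]. *)
Lemma long_bars_le (R : realType) (K : fieldType) (U V W : pmodule R K)
    (f : pmorphism U V) (g : pmorphism V W) (BU BV BW : barcode R)
    (d : R) (LU : seq (bar_index BU)) (LW : seq (bar_index BW))
    (n : nat) (b : nat -> bar_index BV) (s r t : nat -> R) :
  is_barcode U BU -> is_barcode V BV -> is_barcode W BW ->
  (forall a v, g a v = 0 -> exists u, f a u = v) -> 0 < d ->
  (forall j, (d%:E < itv_length (BU j))%E -> j \in LU) ->
  (forall j, (d%:E < itv_length (BW j))%E -> j \in LW) ->
  (forall i l, (i < l)%N -> (l < n)%N -> b i != b l) ->
  (forall i l, (i <= l)%N -> (l < n)%N -> r i <= r l) ->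
  (forall i, (i < n)%N -> [/\ s i \in BV (b i), t i \in BV (b i),
                              s i + d < r i & r i + d < t i]) ->
  (n <= size LU + size LW)%N.
Proof.
move=> hBU hBV hBW kerim d0 hLU hLW binj rmono hb.
have [x [xshift x0 xinj xsurj]] := coordinates hBV.
have e_ex i : exists e : V (s i), (i < n)%N ->
    forall j, x (s i) j e = (j == b i)%:R.
  case: (boolP (i < n)%N) => [/hb[sB _ _ _]|_]; last by exists 0.
  by have [e eE] := xsurj _ _ sB; exists e.
have [e eE] : exists e : forall i, V (s i), forall i, (i < n)%N ->
    forall j, x (s i) j (e i) = (j == b i)%:R.
  by exists (fun i => sval (cid (e_ex i))) => i; exact: svalP (cid (e_ex i)).
have [frW [frW_le frWP]] := eventual_dependence (fun i => g (s i) (e i)) hBW d0 hLW.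
have u_ex l : exists (u : U (r l)), (l < n)%N ->
    if frW l then f (r l) u = 0 else exists c : 'I_l -> K,
    f (r l) u = shift V (s l) (r l) (e l) -
                \sum_(i < l) c i *: shift V (s i) (r l) (e i).
  case: (boolP (l < n)%N) => [ln|_]; last by exists 0.
  case: (boolP (frW l)) => [_|/frWP[c cE]]; first by exists 0; rewrite linear0.
  have [|u uE] := kerim (r l) (shift V (s l) (r l) (e l) -
                \sum_(i < l) c i *: shift V (s i) (r l) (e i)).
    rewrite linearB linear_sum /= pmor_shift cE.
      apply/eqP; rewrite subr_eq0; apply/eqP/eq_bigr => i _.
      by rewrite linearZ /= pmor_shift.
    move=> i il; have [_ _ + _] := hb i (leq_ltn_trans il ln).
    by move/lt_le_trans; apply; exact: rmono.
  by exists u => _; exists c.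
(* At the indices discarded by the first count, any [u l] with zero image
   will do: it then adds nothing to relations among the other ones. *)
have [u uE] : exists u : forall l, U (r l), forall l, (l < n)%N ->
    if frW l then f (r l) (u l) = 0 else exists c : 'I_l -> K,
    f (r l) (u l) = shift V (s l) (r l) (e l) -
                    \sum_(i < l) c i *: shift V (s i) (r l) (e i).
  by exists (fun l => sval (cid (u_ex l))) => l; exact: svalP (cid (u_ex l)).
have [frU [frU_le frUP]] := eventual_dependence u hBU d0 hLU.
have sep i l a : (i < l)%N -> (l < n)%N -> s i <= a ->
    x a (b l) (shift V (s i) a (e i)) = 0.
  move=> il ln sa; rewrite xshift// eE ?(ltn_trans il ln)//.
  by rewrite eq_sym (negbTE (binj _ _ il ln)) if_same.
have sumsep l m (c : 'I_m -> K) a : (m <= l)%N -> (l < n)%N ->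
    (forall i, (i < m)%N -> s i <= a) ->
    x a (b l) (\sum_(i < m) c i *: shift V (s i) a (e i)) = 0.
  move=> ml ln sa; rewrite linear_sum big1// => i _.
  by rewrite linearZ /= sep ?mulr0 ?(leq_trans (ltn_ord i))// sa.
have sler i l : (i <= l)%N -> (l < n)%N -> s i <= r l.
  move=> il ln; have [_ _ sr _] := hb i (leq_ltn_trans il ln).
  by apply: le_trans (rmono i l il ln); lra.
have coord0 i l : (i < l)%N -> (l < n)%N -> x (r i) (b l) (f (r i) (u i)) = 0.
  move=> il ln; have := uE i (ltn_trans il ln).
  case: ifP => _; first by move=> ->; rewrite linear0.
  have iN := ltn_trans il ln.
  move=> -[c ->]; rewrite linearB /= sep ?sler// sumsep ?subr0//.
    exact: ltnW.
  by move=> k ki; apply: sler => //; exact: ltnW.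
have allfr l : (l < n)%N -> frU l || frW l.
  move=> ln; apply: contraT => /norP[/frUP[c cE] /negbTE nfW].
  have [sB tB sr rt] := hb l ln.
  have rlet i : (i <= l)%N -> r i + d < t l.
    by move=> il; have := rmono i l il ln; lra.
  have /(congr1 (f (t l))) := cE (t l) rlet.
  move/(congr1 (x (t l) (b l))); rewrite pmor_shift linear_sum linear_sum /=.
  rewrite [RHS]big1; last first.
    move=> i _; have il := ltn_ord i.
    rewrite linearZ linearZ /= pmor_shift xshift; last first.
      by have := rlet i (ltnW il); lra.
    by rewrite tB coord0// mulr0.
  rewrite xshift; last lra.
  rewrite tB; have := uE l ln; rewrite nfW => -[c' ->].
  rewrite linearB /= sumsep//; last first.
    by move=> k kl; apply: sler => //; exact: ltnW.
  rewrite subr0.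
  have := xshift _ _ (b l) (shift V (s l) (r l) (e l)) (_ : r l <= t l).
  rewrite tB => <-; last lra.
  rewrite shift_comp; [|lra|lra].
  rewrite xshift; last lra.
  by rewrite tB eE// eqxx => /eqP; rewrite oner_eq0.
apply: leq_trans (leq_add (frU_le n) (frW_le n)).
rewrite -big_split /= -[leqLHS]card_ord -sum1_card leq_sum// => i _.
by have := allfr i (ltn_ord i); case: (frU i); case: (frW i).
Qed.

(** * From finite families of bars to the number of bars *)

(** Stated with finite sets so that an upper bound on them also excludes
infinitely many long bars. *)
Lemma nbars_le_fset (R : realType) (B : barcode R) (d : R) (m : nat) :
  (forall A : {fset bar_index B},
     (forall j, j \in A -> (d%:E < itv_length (B j))%E) -> (#|` A| <= m)%N) ->
  (nbars d B <= m%:R%:E)%E.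
Proof.
move=> bnd; rewrite /nbars /counting.
case: asboolP => [fin|/(infinite_set_fset m.+1)[A sub]]; last first.
  by rewrite ltnNge bnd// => j; exact: sub.
by rewrite lee_fin ler_nat bnd// => j; rewrite in_fset_set// inE.
Qed.

Lemma long_bars_seq (R : realType) (B : barcode R) (d : R) :
  nbars d B = +oo%E \/ exists L : seq (bar_index B),
    (forall j, (d%:E < itv_length (B j))%E -> j \in L) /\
    nbars d B = (size L)%:R%:E.
Proof.
rewrite /nbars /counting; case: asboolP => fin; [right|by left].
exists (fset_set [set j | (d%:E < itv_length (B j))%E]%classic); split => // j jB.
by rewrite in_fset_set// inE.
Qed.

Theorem theorem3p1 (R : realType) (K : fieldType) (U V W : pmodule R K)
    (f : pmorphism U V) (g : pmorphism V W)
    (hU : moderate U) (hV : moderate V) (hW : moderate W)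
    (hfg : pexact f g)
    (BU BV BW : barcode R)
    (hBU : is_barcode U BU) (hBV : is_barcode V BV) (hBW : is_barcode W BW)
    (delta : R) (hdelta : 0 < delta) :
  (nbars (2 * delta) BV <= nbars delta BU + nbars delta BW)%E.
Proof.
have nbars_ge0 (B : barcode R) : (0 <= nbars delta B)%E.
  by rewrite /nbars /counting; case: ifP => _; rewrite ?lee_fin ?leey.
have [->|[LU [hLU ->]]] := long_bars_seq BU delta.
  by rewrite addye ?leey// gt_eqF// (lt_le_trans _ (nbars_ge0 _)) ?ltNy0.
have [->|[LW [hLW ->]]] := long_bars_seq BW delta; first by rewrite addey ?leey.
rewrite -EFinD -natrD; apply: nbars_le_fset => A longA.
have /choice[p pP] j : exists q : R * R * R, j \in A ->
    [/\ q.1.1 \in BV j, q.2 \in BV j,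
        q.1.1 + delta < q.1.2 & q.1.2 + delta < q.2].
  case: (boolP (j \in A)) => [jA|_]; last by exists (0, 0, 0).
  by have [q qP] := itv_length_points hdelta (longA j jA); exists q.
pose q := sort (fun i j => (p i).1.2 <= (p j).1.2) A.
have sizeq : size q = #|` A| by rewrite size_sort.
case: (fset_0Vmem A) => [->|[j0 _]]; first by rewrite cardfs0.
have qA i : (i < #|` A|)%N -> nth j0 q i \in A.
  by rewrite -sizeq => /(mem_nth j0); rewrite mem_sort.
apply: (@long_bars_le _ _ _ _ _ f g _ _ _ delta LU LW _ (nth j0 q)
  (fun i => (p (nth j0 q i)).1.1) (fun i => (p (nth j0 q i)).1.2)
  (fun i => (p (nth j0 q i)).2)) => //.
- move=> a v gv0; have : [set w | g a w = 0]%classic v by [].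
  by rewrite -hfg => -[u _ uv]; exists u.
- move=> i l il ln; rewrite nth_uniq ?sizeq ?(ltn_trans il ln)//.
    by rewrite ltn_eqF.
  by rewrite sort_uniq fset_uniq.
- move=> i l il ln.
  apply: (sorted_leq_nth (leT := fun i j => (p i).1.2 <= (p j).1.2)) => //.
  + by move=> y x z; exact: le_trans.
  + by apply: sort_sorted => x y; exact: le_total.
  + by rewrite inE sizeq (leq_ltn_trans il).
  + by rewrite inE sizeq.
- by move=> i iA; exact: pP (qA i iA).
Qed.
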